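(* Let $H$ be a Hilbert module over a $C^*$-algebra. For every idempotent $Q\in\mathcal{L}(H)$, there exist a projection $P\in\mathcal{L}(H)$ and an invertible operator $W\in\mathcal{L}(H)$ such that $(P,Q)$ is a quasi-projection pair satisfying $$Q=W^{-1}PW\quad\text{and}\quad \|I-W\|<1.$$ In particular, $P$ and $Q$ as idempotents are homotopy equivalent.
   Context: $\mathcal{L}(H)$ is the $C^*$-algebra of adjointable operators on the Hilbert $C^*$-module $H$, and $I$ is the identity operator on $H$. An idempotent is $Q\in\mathcal{L}(H)$ with $Q^2=Q$; a projection is an idempotent $P$ with $P^*=P$. An ordered pair $(P,Q)$, with $P\in\mathcal{L}(H)$ a projection and $Q\in\mathcal{L}(H)$ an idempotent, is called a quasi-projection pair if $PQ^*P=PQP$, $PQ^*(I-P)=-PQ(I-P)$, and $(I-P)Q^*(I-P)=(I-P)Q(I-P)$. Two idempotents in $\mathcal{L}(H)$ are homotopy equivalent if there is a norm-continuous path $[0,1]\to\mathcal{L}(H)$ consisting of idempotents which starts at one and ends at the other. *)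

(* Defs.v *)
From HB Require Import structures.
From mathcomp Require Import all_boot all_order all_algebra.
From mathcomp Require Import all_classical all_reals all_analysis.
From mathcomp Require Import complex.

Set Implicit Arguments.
Unset Strict Implicit.
Unset Printing Implicit Defensive.

Import Order.TTheory GRing.Theory Num.Theory.
Import numFieldNormedType.Exports.

Local Open Scope classical_set_scope.
Local Open Scope ring_scope.
Local Open Scope complex_scope.

(* C*-algebras are not required to be unital, which is why the product is not
   that of a MathComp ring. *)
HB.mixin Record isCStarAlgebra (R : realType) A
    of CompleteNormedModule R[i] A := {
  cmul : A -> A -> A;
  cstar : A -> A;
  cmulA : forall a b c, cmul a (cmul b c) = cmul (cmul a b) c;
  cmulDl : forall a b c, cmul (a + b) c = cmul a c + cmul b c;
  cmulDr : forall a b c, cmul a (b + c) = cmul a b + cmul a c;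
  cmulZl : forall (k : R[i]) a b, cmul (k *: a) b = k *: cmul a b;
  cmulZr : forall (k : R[i]) a b, cmul a (k *: b) = k *: cmul a b;
  cstarK : forall a, cstar (cstar a) = a;
  cstarD : forall a b, cstar (a + b) = cstar a + cstar b;
  cstarZ : forall (k : R[i]) a, cstar (k *: a) = k^* *: cstar a;
  cstarM : forall a b, cstar (cmul a b) = cmul (cstar b) (cstar a);
  cnormM : forall a b, `|cmul a b| <= `|a| * `|b|;
  cnorm_cstar : forall a, `|cmul (cstar a) a| = `|a| ^+ 2
}.

#[short(type="cstarAlgType")]
HB.structure Definition CStarAlgebra (R : realType) :=
  {A of isCStarAlgebra R A & CompleteNormedModule R[i] A}.

Definition cpositive (R : realType) (A : cstarAlgType R) (a : A) : Prop :=
  exists b : A, a = cmul (cstar b) b.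

(* Right Hilbert modules, with an inner product that is linear in its second
   argument. Definiteness of the inner product follows from norm_inner and the
   definiteness of the norm. *)
HB.mixin Record isHilbertModule (R : realType) (A : cstarAlgType R) H
    of CompleteNormedModule R[i] H := {
  ract : H -> A -> H;
  inner : H -> H -> A;
  ractDl : forall x y a, ract (x + y) a = ract x a + ract y a;
  ractDr : forall x a b, ract x (a + b) = ract x a + ract x b;
  ractM : forall x a b, ract x (cmul a b) = ract (ract x a) b;
  ractZl : forall (k : R[i]) x a, ract (k *: x) a = k *: ract x a;
  ractZr : forall (k : R[i]) x a, ract x (k *: a) = k *: ract x a;
  innerDr : forall x y z, inner x (y + z) = inner x y + inner x z;
  innerZr : forall (k : R[i]) x y, inner x (k *: y) = k *: inner x y;
  inner_ract : forall x y a, inner x (ract y a) = cmul (inner x y) a;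
  inner_cstar : forall x y, cstar (inner x y) = inner y x;
  inner_pos : forall x, cpositive (inner x x);
  norm_inner : forall x, `|x| ^+ 2 = `|inner x x|
}.

#[short(type="hilbertModType")]
HB.structure Definition HilbertModule (R : realType) (A : cstarAlgType R) :=
  {H of isHilbertModule R A H & CompleteNormedModule R[i] H}.

Section Adjointable.
Context {R : realType} {A : cstarAlgType R} (H : hilbertModType A).
Implicit Types (T S : H -> H) (x y z : H).

Definition is_adjoint T S : Prop :=
  forall x y, inner (T x) y = inner x (S y).

(* Linearity, A-linearity and boundedness are consequences. *)
Definition adjointable T : Prop := exists S, is_adjoint T S.

Record adjop : Type := Adjop {
  adjop_fun :> H -> H;
  adjop_subproof : `[< adjointable adjop_fun >] }.

HB.instance Definition _ := [isSub for adjop_fun].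
HB.instance Definition _ := [Choice of adjop by <:].

Lemma innerDl x y z : inner (x + y) z = inner x z + inner y z.
Proof. by rewrite -inner_cstar innerDr cstarD !inner_cstar. Qed.

Lemma inner0r x : inner x 0 = 0.
Proof. by apply: (addrI (inner x 0)); rewrite -innerDr !addr0. Qed.

Lemma inner0l x : inner 0 x = 0.
Proof. by apply: (addrI (inner 0 x)); rewrite -innerDl !addr0. Qed.

Lemma innerNl x y : inner (- x) y = - inner x y.
Proof. by apply/eqP; rewrite -addr_eq0 -innerDl addNr inner0l. Qed.

Lemma innerNr x y : inner x (- y) = - inner x y.
Proof. by apply/eqP; rewrite -addr_eq0 -innerDr addNr inner0r. Qed.

Lemma inner_inj x y : (forall z, inner x z = inner y z) -> x = y.
Proof.
move=> xy; apply/eqP; rewrite -subr_eq0 -normr_eq0 -sqrf_eq0.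
by rewrite norm_inner normr_eq0 innerDl innerNl xy subrr.
Qed.

Lemma is_adjoint_sym T S : is_adjoint T S -> is_adjoint S T.
Proof. by move=> TS x y; rewrite -inner_cstar -TS inner_cstar. Qed.

Lemma adjointableP (T : adjop) : adjointable T.
Proof. exact/asboolP/adjop_subproof. Qed.

Lemma adjop_eqP (T S : adjop) : T =1 S -> T = S.
Proof. by move=> TS; apply/val_inj/funext. Qed.

Lemma adjopD (T : adjop) x y : T (x + y) = T x + T y.
Proof.
have [S TS] := adjointableP T.
by apply: inner_inj => z; rewrite innerDl !TS innerDl.
Qed.

Lemma adjoint_subproof (T : adjop) :
  `[< adjointable (projT1 (cid (adjointableP T))) >].
Proof.
apply/asboolP; exists (adjop_fun T); apply: is_adjoint_sym.
exact: (projT2 (cid (adjointableP T))).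
Qed.

Definition adjoint (T : adjop) : adjop := Adjop (adjoint_subproof T).

Lemma adjointE (T : adjop) : is_adjoint T (adjoint T).
Proof. exact: (projT2 (cid (adjointableP T))). Qed.

Lemma adjop0_subproof : `[< adjointable (fun=> 0) >].
Proof. by apply/asboolP; exists (fun=> 0) => x y; rewrite inner0l inner0r. Qed.

Lemma adjopN_subproof (T : adjop) : `[< adjointable (fun x => - T x) >].
Proof.
apply/asboolP; exists (fun x => - adjoint T x) => x y.
by rewrite innerNl innerNr adjointE.
Qed.

Lemma adjopD_subproof (T S : adjop) : `[< adjointable (fun x => T x + S x) >].
Proof.
apply/asboolP; exists (fun x => adjoint T x + adjoint S x) => x y.
by rewrite innerDl innerDr !adjointE.
Qed.

Lemma adjop1_subproof : `[< adjointable id >].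
Proof. by apply/asboolP; exists id. Qed.

Lemma adjopM_subproof (T S : adjop) : `[< adjointable (T \o S) >].
Proof.
apply/asboolP; exists (adjoint S \o adjoint T) => x y /=.
by rewrite !adjointE.
Qed.

Definition adjop0 := Adjop adjop0_subproof.
Definition adjop_opp (T : adjop) := Adjop (adjopN_subproof T).
Definition adjop_add (T S : adjop) := Adjop (adjopD_subproof T S).
Definition adjop1 := Adjop adjop1_subproof.
Definition adjop_mul (T S : adjop) := Adjop (adjopM_subproof T S).

Lemma adjop_addA : associative adjop_add.
Proof. by move=> T S U; apply: adjop_eqP => x /=; rewrite addrA. Qed.
Lemma adjop_addC : commutative adjop_add.
Proof. by move=> T S; apply: adjop_eqP => x /=; rewrite addrC. Qed.
Lemma adjop_add0 : left_id adjop0 adjop_add.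
Proof. by move=> T; apply: adjop_eqP => x /=; rewrite add0r. Qed.
Lemma adjop_addN : left_inverse adjop0 adjop_opp adjop_add.
Proof. by move=> T; apply: adjop_eqP => x /=; rewrite addNr. Qed.

HB.instance Definition _ :=
  GRing.isZmodule.Build adjop adjop_addA adjop_addC adjop_add0 adjop_addN.

Lemma adjop_mulA : associative adjop_mul.
Proof. by move=> T S U; apply: adjop_eqP. Qed.
Lemma adjop_mul1l : left_id adjop1 adjop_mul.
Proof. by move=> T; apply: adjop_eqP. Qed.
Lemma adjop_mul1r : right_id adjop1 adjop_mul.
Proof. by move=> T; apply: adjop_eqP. Qed.
Lemma adjop_mulDl : left_distributive adjop_mul +%R.
Proof. by move=> T S U; apply: adjop_eqP. Qed.
Lemma adjop_mulDr : right_distributive adjop_mul +%R.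
Proof. by move=> T S U; apply: adjop_eqP => x /=; rewrite adjopD. Qed.

(* L(H) is the zero ring when H = 0, hence pzRing rather than nzRing. *)
HB.instance Definition _ := GRing.Zmodule_isPzRing.Build adjop
  adjop_mulA adjop_mul1l adjop_mul1r adjop_mulDl adjop_mulDr.

(* The norm of a module over R[i] takes (nonnegative real) values in R[i],
   whence the real part. *)
Definition opnorm (T : adjop) : \bar R :=
  ereal_sup [set (complex.Re `|T x|)%:E | x in [set x : H | `|x| <= 1]].

Definition is_idempotent (Q : adjop) : Prop := Q * Q = Q.

Definition is_projection (P : adjop) : Prop := is_idempotent P /\ adjoint P = P.

Definition quasi_projection_pair (P Q : adjop) : Prop :=
  [/\ is_projection P, is_idempotent Q,
      P * adjoint Q * P = P * Q * P,
      P * adjoint Q * (1 - P) = - (P * Q * (1 - P)) &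
      (1 - P) * adjoint Q * (1 - P) = (1 - P) * Q * (1 - P)].

Definition inverse_of (W V : adjop) : Prop := W * V = 1 /\ V * W = 1.

(* Only the restriction of gamma to [0, 1] matters. *)
Definition homotopy_equivalent (P Q : adjop) : Prop :=
  exists gamma : R -> adjop,
    [/\ gamma 0 = P, gamma 1 = Q,
        forall t : R, t \in `[0, 1] -> is_idempotent (gamma t) &
        forall t : R, t \in `[0, 1] ->
          opnorm (gamma s - gamma t) @[s --> within `[0, 1] (nbhs t)]
            --> 0%E].

End Adjointable.

(* Main.v *)
(** The operator S = 2Q - 1 satisfies S^2 = 1. Put a = S + S^* and z = S - S^*, so
    that a^2 = 4 - z^2 and a z = - z a, and let c be a square root of 4 - z^2
    commuting with a and z (twice the cosh part of |S|). Then J = a c^-1, the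
    unitary part of S, is a symmetry with J z = - z J, and P = (1 + J) / 2 is the
    required projection. With e = (2 + c)^-1, the operator V = (1 + S J) / 2
    satisfies S V = V J, and its inverse is W = 1 - e z J.

    No continuous functional calculus and no order on the C*-algebra are needed:
    square roots and inverses are fixed points of contractions near a multiple of
    the identity, and sharp norm bounds come from writing a skew-adjoint L as the
    half-difference of the unitaries F + L and F - L, where F^2 = 1 + L^2. *)

Require Import Defs.
From HB Require Import structures.
From mathcomp Require Import all_boot all_order all_algebra.
From mathcomp Require Import all_classical all_reals all_analysis.
From mathcomp Require Import complex ring lra.
From Stdlib Require Ncring Ncring_tac.

Set Implicit Arguments.
Unset Strict Implicit.
Unset Printing Implicit Defensive.

Import Order.TTheory GRing.Theory Num.Theory.
Import numFieldNormedType.Exports.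

Local Open Scope ring_scope.

(** * Real-valued norms *)

Section RealNorm.
Local Open Scope complex_scope.
Context {R : realType} {V : normedModType R[i]}.
Implicit Types (x y : V) (r : R).

Definition nrm x : R := complex.Re `|x|.

Lemma nrmE x : `|x| = (nrm x)%:C.
Proof. by rewrite /nrm RRe_real // normr_real. Qed.

Lemma nrm_ge0 x : 0 <= nrm x.
Proof. by rewrite -ler0c -nrmE. Qed.

Lemma nrm0 : nrm (0 : V) = 0.
Proof. by apply: complexI; rewrite -nrmE normr0. Qed.

Lemma nrm_eq0 x : (nrm x == 0) = (x == 0).
Proof. by rewrite -(inj_eq (@complexI R)) -nrmE normr_eq0. Qed.

Lemma nrmN x : nrm (- x) = nrm x.
Proof. by rewrite /nrm normrN. Qed.

Lemma nrmD x y : nrm (x + y) <= nrm x + nrm y.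
Proof. by rewrite -lecR rmorphD /= -!nrmE ler_normD. Qed.

Lemma nrmB x y : nrm (x - y) <= nrm x + nrm y.
Proof. by rewrite -(nrmN y) nrmD. Qed.

Lemma nrmZ r x : nrm (r%:C *: x) = `|r| * nrm x.
Proof.
apply: complexI; rewrite rmorphM /= -!nrmE normrZ; congr (_ * _).
by rewrite normc_def /= expr0n addr0 sqrtr_sqr.
Qed.

End RealNorm.

(** * Limits of geometrically convergent sequences *)

Section Geometric.
Local Open Scope classical_set_scope.
Local Open Scope ring_scope.
Context {R : realType}.
Implicit Types (q c a : R).

Lemma ler_geometric_cst q c a : 0 <= q < 1 ->
  (forall n, a <= c * q ^+ n) -> a <= 0.
Proof.
move=> /andP[q0 q1] ac; have := @cvg_geometric R c q.
rewrite ger0_norm // => /(_ q1) cv.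
rewrite -(cvg_lim _ cv) //; apply: limr_ge; first exact: cvgP cv.
by apply: nearW => n; apply: ac.
Qed.

Context {V : completeNormedModType R[i]}.

(** Completeness with a rate: telescoping bounds the distance to the limit by a geometric tail. *)
Lemma geometric_cauchy_cvg (u : nat -> V) q c : 0 <= q < 1 ->
  (forall n, nrm (u n.+1 - u n) <= c * q ^+ n) ->
  exists l, forall n, nrm (l - u n) <= c / (1 - q) * q ^+ n.
Proof.
move=> q01 uc; have /andP[q0 q1] := q01.
have q1_gt0 : 0 < 1 - q by rewrite subr_gt0.
have c0 : 0 <= c by have := le_trans (nrm_ge0 _) (uc 0%N); rewrite expr0 mulr1.
set c' := c / (1 - q).
have c'0 : 0 <= c' by rewrite divr_ge0 // ltW.
(* The factor [1 - q ^+ k] is that of the finite geometric sum; without it the induction on [k]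
   would not close. *)
have ud n k : nrm (u (n + k)%N - u n) <= c' * q ^+ n * (1 - q ^+ k).
  elim: k => [|k IH]; first by rewrite addn0 subrr nrm0 expr0 subrr mulr0.
  rewrite addnS -(subrK (u (n + k)%N) (u _.+1)) -addrA.
  apply: le_trans (nrmD _ _) (le_trans (lerD (uc _) IH) _).
  rewrite exprD exprS /c' le_eqVlt; apply/orP; left; apply/eqP; field.
  by rewrite gt_eqF.
have ud' n k : nrm (u (n + k)%N - u n) <= c' * q ^+ n.
  apply: le_trans (ud n k) _; apply: ler_piMr.
    by rewrite mulr_ge0 // exprn_ge0.
  by rewrite gerBl exprn_ge0.
have cv0 : (fun n => c' * q ^+ n) @ \oo --> (0 : R).
  by have := @cvg_geometric R c' q; rewrite ger0_norm // => /(_ q1).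
have ucv : cvg (u @ \oo).
  (* The radius is a positive element of [R[i]], so its imaginary part vanishes and its real part is
     positive. *)
  apply/cauchy_cvgP/cauchy_exP => e e0.
  have /andP[_ re0] : (complex.Im e == 0) && (0 < complex.Re e).
    by move: e0; rewrite ltcE /=.
  have /cvgrPdist_lt/(_ _ re0)[N _ NP] := cv0.
  exists (u N); exists N => // n /= Nn.
  rewrite -ball_normE /ball_ /= nrmE.
  have eE : e = ((complex.Re e)%:C)%C by rewrite RRe_real // gtr0_real.
  rewrite eE ltcR -nrmN opprB -(subnKC Nn).
  apply: le_lt_trans (ud' _ _) _.
  apply: le_lt_trans (NP N (leqnn N)).
  by rewrite sub0r normrN ler_norm.
exists (lim (u @ \oo)) => n; apply/ler_addgt0Pr => e e0.
have /cvgrPdist_lt/(_ e%:C%C) := ucv; rewrite ltcR => /(_ e0)[N _ NP].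
have /= := NP (n + N)%N (leq_addl _ _); rewrite nrmE ltcR => /ltW luN.
rewrite -(subrK (u (n + N)%N) (lim _)) -addrA addrC.
exact: le_trans (nrmD _ _) (lerD (ud' _ _) luN).
Qed.


End Geometric.

(** * The Cauchy-Schwarz inequality and automatic boundedness *)

Section CauchySchwarz.
Local Open Scope complex_scope.
Context {R : realType} {A : cstarAlgType R} {H : hilbertModType A}.
Implicit Types (a b : A) (x y : H).

Lemma nrm_cmul a b : nrm (cmul a b) <= nrm a * nrm b.
Proof. by rewrite -lecR rmorphM /= -!nrmE cnormM. Qed.

Lemma nrm_cstar_cmul a : nrm (cmul (cstar a) a) = nrm a ^+ 2.
Proof. by apply: complexI; rewrite rmorphXn /= -!nrmE cnorm_cstar. Qed.

(** From |b|^2 = |b^* b| <= |b^*| |b| one inequality follows for every [b]; taking [a] and [cstar a]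
    for [b] gives both. *)
Lemma nrm_cstar a : nrm (cstar a) = nrm a.
Proof.
suff le b : nrm b <= nrm (cstar b) by apply/le_anti; rewrite le -{2}[a]cstarK le.
have [->|b0] := eqVneq (nrm b) 0; first exact: nrm_ge0.
rewrite -(ler_pM2r (_ : 0 < nrm b)) ?lt_def ?b0 ?nrm_ge0 //.
by rewrite -expr2 -nrm_cstar_cmul nrm_cmul.
Qed.

Lemma nrm_inner_self x : nrm (inner x x) = nrm x ^+ 2.
Proof. by apply: complexI; rewrite rmorphXn /= -!nrmE norm_inner. Qed.

Lemma nrm_inner_sym x y : nrm (inner x y) = nrm (inner y x).
Proof. by rewrite -inner_cstar nrm_cstar. Qed.

Lemma nrm_ract x a : nrm (ract x a) <= nrm x * nrm a.
Proof.
rewrite -(ler_pXn2r (_ : 0 < 2)%N) ?nnegrE ?mulr_ge0 ?nrm_ge0 //.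
rewrite -nrm_inner_self inner_ract -inner_cstar inner_ract cstarM inner_cstar.
apply: le_trans (nrm_cmul _ _) _.
apply: le_trans (ler_wpM2r (nrm_ge0 _) (nrm_cmul _ _)) _.
by rewrite nrm_cstar nrm_inner_self le_eqVlt; apply/orP; left; apply/eqP; ring.
Qed.

Lemma conj_real (r : R) : Num.conj r%:C = r%:C.
Proof. by apply: conj_Creal; rewrite complex_real. Qed.

Lemma innerZl (r : R) x y : inner (r%:C *: x) y = r%:C *: inner x y.
Proof. by rewrite -inner_cstar innerZr cstarZ inner_cstar conj_real. Qed.

(* The constant 2 spares the order on [A]: polarizing [y] against multiples of
   [x <y, x>], the inequality follows from the triangle inequality alone. *)
Lemma nrm_inner_le x y : nrm (inner x y) <= 2 * (nrm x * nrm y).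
Proof.
have [x0|x0] := eqVneq (nrm x) 0.
  have -> : x = 0 by apply/eqP; rewrite -nrm_eq0 x0.
  by rewrite inner0l !nrm0 mul0r mulr0.
have [y0|y0] := eqVneq (nrm y) 0.
  have -> : y = 0 by apply/eqP; rewrite -nrm_eq0 y0.
  by rewrite inner0r !nrm0 !mulr0.
have [m0|m0] := eqVneq (nrm (inner x y)) 0.
  by rewrite m0 !mulr_ge0 ?nrm_ge0.
set X := nrm x; set Y := nrm y; set m := nrm (inner x y).
have X_gt0 : 0 < X by rewrite lt_def x0 nrm_ge0.
have Y_gt0 : 0 < Y by rewrite lt_def y0 nrm_ge0.
have m_gt0 : 0 < m by rewrite lt_def m0 nrm_ge0.
(* [l] is chosen so that |z| <= |y| l |<y, x>| = |x|. *)
pose l := X / (Y * m); have l_gt0 : 0 < l by rewrite divr_gt0 ?mulr_gt0.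
pose z := ract y (l%:C *: inner y x).
have nz : nrm z <= X.
  apply: le_trans (nrm_ract _ _) _.
  rewrite nrmZ gtr0_norm // nrm_inner_sym -/m -/Y /l.
  by rewrite le_eqVlt; apply/orP; left; apply/eqP; field; rewrite y0 m0.
pose c := l%:C *: cmul (cstar (inner y x)) (inner y x).
have xz : inner x z = c by rewrite /z inner_ract cmulZr -[inner x y]inner_cstar.
have zx : inner z x = c.
  by rewrite -inner_cstar xz /c cstarZ conj_real cstarM cstarK.
have pol : inner (x + z) (x + z) - inner (x - z) (x - z) = 4%:R%:C *: c.
  have e b : inner x x + b + (b + inner z z) = b *+ 2 + (inner x x + inner z z).
    by rewrite [_ + b]addrC addrACA -mulr2n.
  rewrite !(innerDl, innerDr) !innerNl !innerNr xz zx opprK !e mulNrn.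
  by rewrite opprD opprK addrACA subrr addr0 rmorph_nat scaler_nat (mulrnDr c 2 2).
have nc : nrm c = l * m ^+ 2.
  by rewrite /c nrmZ gtr0_norm // nrm_cstar_cmul nrm_inner_sym.
have := nrmB (inner (x + z) (x + z)) (inner (x - z) (x - z)).
rewrite pol nrmZ nc !nrm_inner_self ger0_norm ?ler0n //.
have h1 : nrm (x + z) ^+ 2 <= 4 * X ^+ 2.
  have -> : 4 * X ^+ 2 = (X + X) ^+ 2 by ring.
  by rewrite ler_pXn2r ?nnegrE ?nrm_ge0 ?addr_ge0 ?nrm_ge0 // (le_trans (nrmD _ _)) // lerD2l.
have h2 : nrm (x - z) ^+ 2 <= 4 * X ^+ 2.
  have -> : 4 * X ^+ 2 = (X + X) ^+ 2 by ring.
  by rewrite ler_pXn2r ?nnegrE ?nrm_ge0 ?addr_ge0 ?nrm_ge0 // (le_trans (nrmB _ _)) // lerD2l.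
move=> h; have {h1 h2}h := le_trans h (lerD h1 h2); move: h.
have -> : 4 * (l * m ^+ 2) = m * (4 * X / Y).
  by rewrite /l; field; rewrite y0 m0.
have -> : 4 * X ^+ 2 + 4 * X ^+ 2 = 2 * (X * Y) * (4 * X / Y) by field.
by rewrite ler_pM2r // divr_gt0 // mulr_gt0.
Qed.

Lemma adjopN (T : adjop H) x : T (- x) = - T x.
Proof.
apply: inner_inj => z; rewrite innerNl.
by have [S TS] := adjointableP T; rewrite !TS innerNl.
Qed.

Lemma adjop_fun0 (T : adjop H) : T 0 = 0.
Proof. by apply: (addrI (T 0)); rewrite -adjopD !addr0. Qed.

Lemma adjopZ (T : adjop H) (r : R) x : T (r%:C *: x) = r%:C *: T x.
Proof.
have [S TS] := adjointableP T.
by apply: inner_inj => z; rewrite innerZl !TS innerZl.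
Qed.

(** Estimates carry an explicit real constant; [opnorm_le] translates them to the extended-real
    [opnorm] at the end. *)
Definition bounded_by (T : H -> H) (r : R) := forall x, nrm (T x) <= r * nrm x.

(* Gliding hump: if [T] is unbounded, pick unit vectors [u n] with
   [|T (u n)| > n 5^n] and form [x] as the sum of [+- 5^-n T (u n) / |T (u n)|],
   with signs chosen so that [|<T (u n), x>| >= 5^-n |T (u n)| / 2]; this
   contradicts [|<T (u n), x>| <= 2 |T^* x|]. *)
Lemma adjop_bounded (T : adjop H) : exists2 r, 0 <= r & bounded_by T r.
Proof.
apply: contrapT => unb.
have /choice[u uP] (n : nat) :
    exists u : H, nrm u <= 1 /\ n%:R * 5 ^+ n < nrm (T u).
  apply: contrapT => /forallNP ub; apply: unb; exists (n%:R * 5 ^+ n) => [|x].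
    by rewrite mulr_ge0 // exprn_ge0.
  have [->|x0] := eqVneq x 0.
    by rewrite adjop_fun0 nrm0 mulr0.
  have nx : 0 < nrm x by rewrite lt_def nrm_ge0 nrm_eq0 x0.
  have := ub ((nrm x)^-1%:C *: x).
  rewrite adjopZ !nrmZ gtr0_norm ?invr_gt0 // mulVf ?gt_eqF // => /not_andP[].
    by rewrite lexx.
  by move/negP; rewrite -leNgt ler_pdivrMl // mulrC.
pose w n : H := T (u n).
pose v n : H := (5 ^- n / nrm (w n))%:C *: w n.
have wn n : n%:R * 5 ^+ n < nrm (w n) := (uP n).2.
have w_gt0 n : 0 < nrm (w n).
  by apply: le_lt_trans (wn n); rewrite mulr_ge0 // exprn_ge0.
have e5 n : 0 < 5 ^- n :> R by rewrite invr_gt0 exprn_gt0.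
have nv n : nrm (v n) = 5 ^- n.
  by rewrite nrmZ gtr0_norm ?divr_gt0 // divfK // gt_eqF.
have wv n : nrm (inner (w n) (v n)) = 5 ^- n * nrm (w n).
  rewrite innerZr nrmZ gtr0_norm ?divr_gt0 // nrm_inner_self.
  by rewrite expr2 mulrA divfK // gt_eqF.
pose step n x := if nrm (inner (w n) (v n)) <= nrm (inner (w n) (x + v n))
  then x + v n else x - v n.
have stepP n x : nrm (inner (w n) (v n)) <= nrm (inner (w n) (step n x)).
  (* The two candidates differ by [2 v n]: if the first gives too small a value, the triangle
     inequality makes the second large enough. *)
  rewrite /step; case: ifPn => //; rewrite -ltNge => lt.
  have := nrmB (inner (w n) (x + v n)) (inner (w n) (x - v n)).
  rewrite -innerNr -innerDr (_ : x + v n - (x - v n) = 2%:R%:C *: v n); last first.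
    by rewrite opprB addrC addrA subrK rmorph_nat scaler_nat mulr2n.
  rewrite innerZr nrmZ ger0_norm //; lra.
have stepB n x : nrm (step n x - x) <= 1 * 5^-1 ^+ n.
  rewrite mul1r exprVn -nv /step; case: ifP => _; first by rewrite addrC addKr.
  by rewrite addrC addKr nrmN.
pose x_ := fix f n := if n is m.+1 then step m (f m) else 0.
have [x xP] : exists l, forall n, nrm (l - x_ n) <= 1 / (1 - 5^-1) * 5^-1 ^+ n.
  apply: geometric_cauchy_cvg => [|n]; first by apply/andP; split; lra.
  exact: stepB.
pose S := adjoint T.
have up n : nrm (inner (w n) x) <= 2 * nrm (S x).
  rewrite adjointE; apply: le_trans (nrm_inner_le _ _) _.
  by rewrite ler_wpM2l // ler_piMl ?nrm_ge0 //; case: (uP n).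
have low n : 5 ^- n * nrm (w n) <= 2 * nrm (inner (w n) x).
  have h1 := stepP n (x_ n); rewrite wv -[step n _]/(x_ n.+1) in h1.
  have h2 := nrmB (inner (w n) x) (inner (w n) (x - x_ n.+1)).
  rewrite -innerNr -innerDr opprB addrC subrK in h2.
  (* The tail beyond [x_ n.+1] is at most 5^-n / 4, which the constant 2 of [nrm_inner_le] doubles;
     at least half of 5^-n |w n| remains. *)
  have h3 := nrm_inner_le (w n) (x - x_ n.+1).
  have h4 : nrm (w n) * nrm (x - x_ n.+1) <= nrm (w n) * (4^-1 * 5 ^- n).
    rewrite ler_wpM2l ?nrm_ge0 // (le_trans (xP _)) // exprS exprVn mulrA.
    by rewrite (_ : 1 / (1 - 5^-1) / 5 = 4^-1) //; field.
  have : nrm (w n) * (4^-1 * 5 ^- n) = 4^-1 * (5 ^- n * nrm (w n)) by ring.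
  lra.
have big n : n%:R <= 4 * nrm (S x).
  have h : n%:R < 5 ^- n * nrm (w n).
    by rewrite mulrC ltr_pdivlMr ?exprn_gt0.
  by have := low n; have := up n; lra.
have := big (Num.truncn (4 * nrm (S x))).+1.
by rewrite leNgt truncnS_gt.
Qed.

End CauchySchwarz.

(** * Adjointable operators *)

Section AdjointAlgebra.
Local Open Scope complex_scope.
Context {R : realType} {A : cstarAlgType R} {H : hilbertModType A}.
Implicit Types (T S : adjop H) (r s : R) (x y : H).

Lemma is_adjoint_eq T S : is_adjoint T S -> adjoint T = S.
Proof.
move=> TS; apply: adjop_eqP => x; apply: inner_inj => z.
by rewrite -[LHS]inner_cstar -[RHS]inner_cstar -TS adjointE.
Qed.

Lemma adjointK T : adjoint (adjoint T) = T.
Proof. exact/is_adjoint_eq/is_adjoint_sym/adjointE. Qed.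

Lemma adjointD T S : adjoint (T + S) = adjoint T + adjoint S.
Proof. by apply: is_adjoint_eq => x y /=; rewrite innerDl innerDr !adjointE. Qed.

Lemma adjointN T : adjoint (- T) = - adjoint T.
Proof. by apply: is_adjoint_eq => x y /=; rewrite innerNl innerNr adjointE. Qed.

Lemma adjointB T S : adjoint (T - S) = adjoint T - adjoint S.
Proof. by rewrite adjointD adjointN. Qed.

Lemma adjointM T S : adjoint (T * S) = adjoint S * adjoint T.
Proof. by apply: is_adjoint_eq => x y /=; rewrite !adjointE. Qed.

Lemma adjoint0 : adjoint (0 : adjop H) = 0.
Proof. by apply: is_adjoint_eq => x y /=; rewrite inner0l inner0r. Qed.

Lemma adjoint1 : adjoint (1 : adjop H) = 1.
Proof. exact: is_adjoint_eq. Qed.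

Lemma scalar_op_is_adjoint r :
  is_adjoint (fun x : H => r%:C *: x) (fun x : H => r%:C *: x).
Proof. by move=> x y; rewrite innerZl innerZr. Qed.

(** Scaling becomes multiplication by a central element, so that identities can be computed in the
    ring of operators alone. *)
Definition sc r : adjop H :=
  Adjop (asboolT (ex_intro _ _ (scalar_op_is_adjoint r))).

Lemma adjoint_sc r : adjoint (sc r) = sc r.
Proof. exact/is_adjoint_eq/scalar_op_is_adjoint. Qed.

Lemma sc_is_additive : zmod_morphism sc.
Proof. by move=> r s; apply: adjop_eqP => x /=; rewrite rmorphB scalerBl. Qed.

Lemma sc_is_monoid_morphism : monoid_morphism sc.
Proof.
split=> [|r s]; first by apply: adjop_eqP => x /=; rewrite scale1r.
by apply: adjop_eqP => x /=; rewrite rmorphM scalerA.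
Qed.

HB.instance Definition _ := GRing.isZmodMorphism.Build R (adjop H) sc sc_is_additive.
HB.instance Definition _ := GRing.isMonoidMorphism.Build R (adjop H) sc sc_is_monoid_morphism.

Lemma scC r T : T * sc r = sc r * T.
Proof. by apply: adjop_eqP => x /=; rewrite adjopZ. Qed.

Lemma bounded_by_le T r s : r <= s -> bounded_by T r -> bounded_by T s.
Proof. by move=> rs Tr x; apply: le_trans (Tr x) (ler_wpM2r (nrm_ge0 x) rs). Qed.

Lemma bounded_byN T r : bounded_by T r -> bounded_by (- T) r.
Proof. by move=> Tr x /=; rewrite nrmN. Qed.

Lemma bounded_byD T S r s :
  bounded_by T r -> bounded_by S s -> bounded_by (T + S) (r + s).
Proof.
by move=> Tr Ss x; rewrite mulrDl (le_trans (nrmD _ _)) // lerD.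
Qed.

Lemma bounded_byM T S r s : 0 <= r ->
  bounded_by T r -> bounded_by S s -> bounded_by (T * S) (r * s).
Proof.
move=> r0 Tr Ss x; apply: le_trans (Tr _) _.
by rewrite -mulrA ler_wpM2l.
Qed.

Lemma bounded_by_sc r T s : bounded_by T s -> bounded_by (sc r * T) (`|r| * s).
Proof. by move=> Ts x /=; rewrite nrmZ -mulrA ler_wpM2l. Qed.

Lemma bounded_by_geometric_eq0 T (c q : R) : 0 <= q < 1 ->
  (forall n, bounded_by T (c * q ^+ n)) -> T = 0.
Proof.
move=> q01 Tc; apply: adjop_eqP => x /=; apply/eqP.
rewrite -nrm_eq0 eq_le nrm_ge0 andbT.
apply: (@ler_geometric_cst _ q (c * nrm x)) => // n.
by rewrite mulrAC; exact: Tc.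
Qed.

Lemma isometry_nrm T x : adjoint T * T = 1 -> nrm (T x) = nrm x.
Proof.
move=> TT; apply/eqP; rewrite -(eqrXn2 (_ : 0 < 2)%N) ?nrm_ge0 //.
by rewrite -!nrm_inner_self adjointE -[adjoint T (T x)]/((adjoint T * T) x) TT.
Qed.

(** The limit is taken pointwise. Symmetry of the inner product relation passes to it, and a
    symmetric map is adjointable, so linearity and boundedness need no separate check. *)
Lemma selfadjoint_geometric_limit (Y : nat -> adjop H) (c q : R) : 0 <= q < 1 ->
  (forall n, adjoint (Y n) = Y n) ->
  (forall n, bounded_by (Y n.+1 - Y n) (c * q ^+ n)) ->
  exists2 T, adjoint T = T & forall n, bounded_by (T - Y n) (c / (1 - q) * q ^+ n).
Proof.
move=> q01 Ysa Yc; have /andP[q0 q1] := q01.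
have /choice[l lP] x :
    exists l : H, forall n, nrm (l - Y n x) <= c * nrm x / (1 - q) * q ^+ n.
  by apply: geometric_cauchy_cvg => // n; rewrite mulrAC; exact: Yc.
have ladj : is_adjoint l l.
  move=> x y; apply/eqP; rewrite -subr_eq0 -nrm_eq0 eq_le nrm_ge0 andbT.
  pose k (z : H) := c * nrm z / (1 - q).
  apply: (@ler_geometric_cst _ q (2 * (k x * nrm y) + 2 * (nrm x * k y))) => // n.
  (* The inserted terms cancel because [Y n] is self-adjoint. *)
  have -> : inner (l x) y - inner x (l y) =
      inner (l x - Y n x) y - inner x (l y - Y n y).
    by rewrite innerDl innerNl innerDr innerNr -[in inner (Y n x) y]Ysa
         (is_adjoint_sym (adjointE _)) opprB addrA subrK.
  apply: le_trans (nrmB _ _) _; rewrite mulrDl.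
  have kxn := lP x n; have kyn := lP y n.
  apply: lerD; apply: le_trans (nrm_inner_le _ _) _; rewrite -mulrA ler_wpM2l //.
    by rewrite mulrAC ler_wpM2r ?nrm_ge0.
  by rewrite -mulrA ler_wpM2l ?nrm_ge0.
have lT : `[< adjointable l >] by apply/asboolP; exists l.
exists (Adjop lT) => [|n x /=]; first exact: is_adjoint_eq.
by rewrite mulrAC [_ / _ * nrm x]mulrAC; exact: lP.
Qed.

(** * Contractions on a ball in a bicommutant *)

Section FixedPoint.
Variables (X : adjop H) (b q : R) (f : adjop H -> adjop H).
Hypotheses (b0 : 0 <= b) (q01 : 0 <= q < 1).

(** Commuting with the commutant of [X] plays the role of being a limit of polynomials in [X]: such
    operators commute with [X] and with each other, and the property survives limits. *)
Definition in_bicommutant_ball T := [/\ adjoint T = T, bounded_by T b &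
  forall B, B * X = X * B -> B * T = T * B].

Hypothesis fP : forall T, in_bicommutant_ball T -> in_bicommutant_ball (f T).
Hypothesis f_contr : forall T S r, in_bicommutant_ball T ->
  in_bicommutant_ball S -> bounded_by (T - S) r -> bounded_by (f T - f S) (q * r).

(** Banach iteration from 0: successive iterates differ by at most b q^n, and the conditions
    defining the ball pass to the limit. *)
Lemma bicommutant_fixed_point : exists2 T, in_bicommutant_ball T & f T = T.
Proof.
have /andP[q0 q1] := q01.
pose Y n := iter n f 0.
have P0 : in_bicommutant_ball 0.
  split=> [|x|B _]; rewrite ?adjoint0 ?mulr0 ?mul0r //=.
  by rewrite nrm0 mulr_ge0 ?nrm_ge0.
have PY n : in_bicommutant_ball (Y n).
  by elim: n => [|n IH]; [exact: P0 | exact: fP].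
have dY n : bounded_by (Y n.+1 - Y n) (b * q ^+ n).
  elim: n => [|n IH]; last first.
    by rewrite exprS mulrCA; exact: f_contr (PY _) (PY _) IH.
  by rewrite expr0 mulr1 subr0; case: (PY 1%N).
have [T Tsa TY] := selfadjoint_geometric_limit q01 (fun n => let: And3 h _ _ := PY n in h) dY.
pose k := b / (1 - q).
have PT : in_bicommutant_ball T.
  split=> // [x|B BX].
    rewrite -subr_le0; apply: (@ler_geometric_cst _ q (k * nrm x)) => // n.
    rewrite lerBlDr -(subrK (Y n x) (T x)) mulrAC.
    by apply: le_trans (nrmD _ _) (lerD (TY n x) _); case: (PY n).
  (* Automatic boundedness of [B] lets the commutation with [Y n] pass to the limit. *)
  have [r r0 Br] := adjop_bounded B.
  apply/eqP; rewrite -subr_eq0; apply/eqP.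
  apply: (@bounded_by_geometric_eq0 _ (r * k + k * r) q) => // n.
  have -> : B * T - T * B = B * (T - Y n) - (T - Y n) * B.
    rewrite mulrBr mulrBl; case: (PY n) => _ _ /(_ _ BX) ->.
    by rewrite opprB addrA subrK.
  have kn : 0 <= k * q ^+ n by rewrite mulr_ge0 ?exprn_ge0 // divr_ge0 // subr_ge0 ltW.
  have -> : (r * k + k * r) * q ^+ n = r * (k * q ^+ n) + k * q ^+ n * r by ring.
  by apply: bounded_byD; [|apply: bounded_byN]; apply: bounded_byM.
(* Both [f T] and [T] lie within a fixed multiple of q^n of [Y n.+1]. *)
exists T => //; apply/eqP; rewrite -subr_eq0; apply/eqP.
apply: (@bounded_by_geometric_eq0 _ (q * k + k * q) q) => // n.
rewrite -(subrK (Y n.+1) (f T)) -addrA mulrDl; apply: bounded_byD.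
  by rewrite -mulrA; exact: f_contr PT (PY _) (TY _).
rewrite -opprB -mulrA -exprS; exact: bounded_byN.
Qed.

End FixedPoint.

End AdjointAlgebra.

(** * Square roots and inverses near the scalars *)

Section NonCommutativeRing.
Context (B : pzRingType).

(** Makes the tactic [nc_ring] available for identities between operators. *)
#[global] Instance pzRing_Ncring_ops :
  @Ncring.Ring_ops B 0 1 +%R *%R (fun x y => x - y) -%R eq.
Defined.

#[global] Instance pzRing_Ncring :
  @Ncring.Ring B _ _ _ _ _ _ _ pzRing_Ncring_ops.
Proof.
split=> //.
- exact: RelationClasses.eq_equivalence.
- by move=> ? ? -> ? ? ->.
- by move=> ? ? -> ? ? ->.
- by move=> ? ? -> ? ? ->.
- by move=> ? ? ->.
- exact: add0r.
- exact: addrC.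
- exact: addrA.
- exact: mul1r.
- exact: mulr1.
- exact: mulrA.
- exact: mulrDl.
- by move=> x y z; exact: mulrDr.
- exact: subrr.
Qed.

End NonCommutativeRing.

Ltac nc_ring := Ncring_tac.non_commutative_ring.

Section NearScalar.
Context {R : realType} {A : cstarAlgType R} {H : hilbertModType A}.
Implicit Types (T S N G : adjop H) (m q s r : R).

(* Stands in for positivity and invertibility, which would need the order on
   the C*-algebra. *)
Definition near_scalar N m q :=
  [/\ 0 < m, 0 <= q < 1, adjoint N = N & bounded_by (sc m - N) (q * m)].

Definition commutes_with_commutant N G := forall B, B * N = N * B -> B * G = G * B.

Lemma sc_halfD T : sc 2^-1 * T + sc 2^-1 * T = T.
Proof.
rewrite -mulrDl -rmorphD /= (_ : 2^-1 + 2^-1 = 1 :> R) ?rmorph1 ?mul1r //.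
by field.
Qed.

Lemma near_scalarD N m q s : 0 <= s -> near_scalar N m q ->
  near_scalar (sc s + N) (s + m) q.
Proof.
move=> s0 [m0 q01 Nsa Nm]; have /andP[q0 _] := q01; split=> //.
- exact: ltr_wpDl.
- by rewrite adjointD adjoint_sc Nsa.
- rewrite rmorphD opprD addrACA subrr add0r.
  by apply: bounded_by_le Nm; rewrite ler_wpM2l // lerDr.
Qed.

(** Reduces square roots and inverses of [N] to those of [1 - X], where [X] has norm at most q <
    1. *)
Lemma near_scalar_remainder N m q : near_scalar N m q ->
  let X := sc m^-1 * (sc m - N) in
  [/\ adjoint X = X, bounded_by X q, N = sc m * (1 - X) &
      forall B, B * N = N * B -> B * X = X * B].
Proof.
move=> [m0 q01 Nsa Nm] X; split.
- by rewrite /X adjointM adjointB !adjoint_sc Nsa scC.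
- have := bounded_by_sc m^-1 Nm.
  by rewrite gtr0_norm ?invr_gt0 // mulrCA mulVf ?gt_eqF // mulr1.
- rewrite /X mulrBr mulr1 mulrA -rmorphM /= mulfV ?gt_eqF // rmorph1 mul1r.
  by rewrite opprB addrC subrK.
- by move=> B BN; rewrite /X mulrA scC -!mulrA mulrBr mulrBl BN scC.
Qed.

(** Writing the root of 1 - X as 1 - T turns the equation into T = (X + T^2) / 2. The right side
    preserves the ball of radius q, as (q + q^2) / 2 <= q, and contracts it by the factor q, since
    commuting T and S satisfy T^2 - S^2 = (T + S)(T - S). *)
Lemma near_scalar_sqrt N m q : near_scalar N m q ->
  exists G, [/\ near_scalar G (Num.sqrt m) q, G * G = N &
                commutes_with_commutant N G].
Proof.
move=> Nm; have [m0 q01 Nsa _] := Nm; have /andP[q0 q1] := q01.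
have [Xsa Xq NX XC] := near_scalar_remainder Nm; set X := sc _ * _ in Xsa Xq NX XC.
pose h : adjop H := sc 2^-1.
have hh := sc_halfD; rewrite -/h in hh.
have hC T : T * h = h * T := scC _ T.
have hb T r : bounded_by T r -> bounded_by (h * T) (2^-1 * r).
  by move=> /(bounded_by_sc 2^-1); rewrite gtr0_norm.
have [||||T [Tsa Tq TC] fT] :=
    @bicommutant_fixed_point _ _ _ X q q (fun T => h * (X + T * T)).
- by [].
- by [].
- move=> T [Tsa Tq TC]; split.
  + by rewrite adjointM adjointD adjointM Xsa Tsa adjoint_sc hC.
  + have := hb _ _ (bounded_byD Xq (bounded_byM q0 Tq Tq)).
    by apply: bounded_by_le; nra.
  + move=> B BX; rewrite mulrA hC -!mulrA; congr (_ * _).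
    have BT := TC B BX; rewrite mulrDr mulrDl BX.
    by rewrite [B * _]mulrA BT -mulrA BT mulrA.
- move=> T S r [_ Tq TC] [_ Sq SC] TSr.
  have TS : T * S = S * T by apply: SC; rewrite -TC.
  have -> : h * (X + T * T) - h * (X + S * S) = h * ((T + S) * (T - S)).
    rewrite -mulrBr; congr (_ * _).
    by rewrite mulrDl !mulrBr -TS; nc_ring.
  have := hb _ _ (bounded_byM (addr_ge0 q0 q0) (bounded_byD Tq Sq) TSr).
  by rewrite (_ : 2^-1 * ((q + q) * r) = q * r) //; field.
have sq : Num.sqrt m * Num.sqrt m = m by rewrite -expr2 sqr_sqrtr ?ltW.
have sm0 : 0 < Num.sqrt m by rewrite sqrtr_gt0.
exists (sc (Num.sqrt m) * (1 - T)); split.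
- split=> //.
  + by rewrite adjointM adjointB adjoint1 adjoint_sc Tsa scC.
  + rewrite mulrBr mulr1 opprB addrC subrK.
    by have := bounded_by_sc (Num.sqrt m) Tq; rewrite gtr0_norm // mulrC.
- rewrite -mulrA [_ * (sc _ * _)]mulrA scC !mulrA -rmorphM /= sq NX -mulrA.
  congr (_ * _).
  have e : T + T = X + T * T by rewrite -{1 2}fT hh.
  have -> : X = T + T - T * T by rewrite e addrK.
  by nc_ring.
- move=> B /XC/TC BT.
  by rewrite mulrA scC -!mulrA mulrBr mulrBl BT mulr1 mul1r.
Qed.

(** The Neumann series as a fixed point: the inverse of 1 - X is 1 + T with T = X + X T, and q / (1
    - q) is the sum of the powers q^n for n >= 1. *)
Lemma near_scalar_inv N m q : near_scalar N m q ->
  exists G, [/\ adjoint G = G, N * G = 1 & G * N = 1].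
Proof.
move=> Nm; have [m0 q01 Nsa _] := Nm; have /andP[q0 q1] := q01.
have [Xsa Xq NX XC] := near_scalar_remainder Nm; set X := sc _ * _ in Xsa Xq NX XC.
have q1' : 0 < 1 - q by rewrite subr_gt0.
have [||||T [Tsa Tq TC] fT] :=
    @bicommutant_fixed_point _ _ _ X (q / (1 - q)) q (fun T => X + X * T).
- by rewrite divr_ge0 // ltW.
- by [].
- move=> T [Tsa Tq TC]; split.
  + by rewrite adjointD adjointM Xsa Tsa TC.
  + have -> : q / (1 - q) = q + q * (q / (1 - q)) by field; rewrite gt_eqF.
    exact: bounded_byD Xq (bounded_byM q0 Xq Tq).
  + move=> B BX; have BT := TC B BX; rewrite mulrDr mulrDl BX.
    by rewrite [B * _]mulrA BX -mulrA BT mulrA.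
- move=> T S r _ _ TSr.
  rewrite (_ : X + X * T - (X + X * S) = X * (T - S)); last by nc_ring.
  exact: bounded_byM.
have mm : sc m * sc m^-1 = 1 :> adjop H by rewrite -rmorphM mulfV ?gt_eqF ?rmorph1.
have l1 : (1 - X) * (1 + T) = 1.
  have -> : (1 - X) * (1 + T) = 1 + (T - (X + X * T)) by nc_ring.
  by rewrite fT subrr addr0.
have r1 : (1 + T) * (1 - X) = 1.
  have -> : (1 + T) * (1 - X) = 1 + (T - (X + T * X)) by nc_ring.
  by rewrite -TC // fT subrr addr0.
exists (sc m^-1 * (1 + T)); split.
- by rewrite adjointM adjointD adjoint1 adjoint_sc Tsa scC.
- by rewrite NX -mulrA [_ * (sc _ * _)]mulrA scC !mulrA mm mul1r l1.
- rewrite NX -mulrA [_ * (sc m * _)]mulrA scC -mulrA r1 mulr1.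
  by rewrite -rmorphM mulVf ?gt_eqF ?rmorph1.
Qed.


End NearScalar.

(** * Skew-adjoint operators *)

Section SkewAdjoint.
Context {R : realType} {A : cstarAlgType R} {H : hilbertModType A}.
Implicit Types (T S B c e z w : adjop H) (m q r s t : R).

Lemma isometry_bounded T : adjoint T * T = 1 -> bounded_by T 1.
Proof. by move=> TT x; rewrite isometry_nrm // mul1r. Qed.

Lemma sc_comm r B T : B * T = T * B -> B * (sc r * T) = sc r * T * B.
Proof. by rewrite mulrA scC -!mulrA => ->. Qed.

Lemma sc_mul r s T S : sc r * T * (sc s * S) = sc (r * s) * (T * S).
Proof. by rewrite -mulrA [T * _]mulrA scC -mulrA mulrA -rmorphM. Qed.

Lemma sc2E : sc 2 = 1 + 1 :> adjop H.
Proof. by rewrite rmorphD rmorph1. Qed.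

Lemma sc4E : sc 4 = 1 + 1 + (1 + 1) :> adjop H.
Proof. by rewrite -sc2E -rmorphD -natrD. Qed.

Lemma sc8E : sc 8 = sc 4 + sc 4 :> adjop H.
Proof. by rewrite -rmorphD -natrD. Qed.

Lemma commute_inverse c e B : c * e = 1 -> e * c = 1 -> B * c = c * B ->
  B * e = e * B.
Proof. by move=> ce ec Bc; rewrite -[LHS]mul1r -ec -mulrA [c * _]mulrA -Bc -mulrA ce mulr1. Qed.

(* [F + w] and [F - w] are mutually adjoint unitaries. *)
Lemma skew_dilation w F : adjoint w = - w -> adjoint F = F -> F * F = 1 + w * w ->
  w * F = F * w ->
  [/\ bounded_by (F + w) 1, bounded_by (F - w) 1 &
      (F + w) * (F + w) + (F - w) * (F - w) = 1 + 1 + (w * w + w * w + (w * w + w * w))].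
Proof.
move=> wskew Fsa FF wF.
have e1 : (F - w) * (F + w) = 1.
  have -> : (F - w) * (F + w) = F * F + (F * w - w * F) - w * w by nc_ring.
  by rewrite FF wF subrr addr0 addrK.
have e2 : (F + w) * (F - w) = 1.
  have -> : (F + w) * (F - w) = F * F + (w * F - F * w) - w * w by nc_ring.
  by rewrite FF wF subrr addr0 addrK.
split.
- by apply: isometry_bounded; rewrite adjointD Fsa wskew.
- by apply: isometry_bounded; rewrite adjointB Fsa wskew opprK.
- have -> : (F + w) * (F + w) + (F - w) * (F - w) =
    F * F + F * F + (w * w + w * w) by nc_ring.
  by rewrite FF; nc_ring.
Qed.

(** Stands for the positivity and invertibility of s + z^* z. The point is to bound 2 k + z^2 by 2 k
    alone, with no extra term in |z|^2: it is k times the sum of the squares of the unitaries F + w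
    and F - w. *)
Lemma skew_near_scalar z s : adjoint z = - z -> 0 < s ->
  exists m q, near_scalar (sc s - z * z) m q.
Proof.
move=> zskew s0; have [b b0 zb] := adjop_bounded z.
(* Scaling by [t] brings the norm of [z] down to at most 1/2, so that 1 + w^2 is near 1. *)
pose t := (2 * (1 + b))^-1; have t0 : 0 < t by rewrite invr_gt0; lra.
pose w := sc t * z.
have ww : w * w = sc (t * t) * (z * z).
  exact: sc_mul.
have wskew : adjoint w = - w by rewrite adjointM adjoint_sc zskew scC mulrN.
have wb : bounded_by w 2^-1.
  apply: bounded_by_le (bounded_by_sc t zb).
  rewrite gtr0_norm // /t invfM -mulrA ler_piMr // ler_pdivrMl; lra.
have n1 : near_scalar (1 + w * w) 1 (2^-1 * 2^-1).
  split=> //.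
  - by apply/andP; split; lra.
  - by rewrite adjointD adjoint1 adjointM wskew mulrNN.
  - rewrite rmorph1 opprD addrA subrr sub0r mulr1.
    by apply/bounded_byN/bounded_byM.
have [F [[_ _ Fsa _] FF FC]] := near_scalar_sqrt n1.
have wF : w * F = F * w by apply: FC; nc_ring.
have [u1 v1 uv] := skew_dilation wskew Fsa FF wF.
(* Normalized so that 4 k w^2 = z^2. *)
pose k := (4 * (t * t))^-1.
have k0 : 0 < k by rewrite invr_gt0 !mulr_gt0.
have p0 : 0 < s + (k + k) by lra.
exists (s + (k + k)), ((k + k) / (s + (k + k))); split=> //.
- by rewrite divr_ge0 ?ltr_pdivrMr /=; lra.
- by rewrite adjointB adjoint_sc adjointM zskew mulrNN.
- rewrite divfK ?gt_eqF //.
  have -> : sc (s + (k + k)) - (sc s - z * z) =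
      sc k * ((F + w) * (F + w) + (F - w) * (F - w)).
    rewrite uv mulrDr (rmorphD _ s) opprB [z * z - _]addrC addrACA addrA subrr add0r.
    congr (_ + _); first by rewrite mulrDr mulr1 -rmorphD.
    rewrite !mulrDr ww mulrA -rmorphM -!mulrDl -!rmorphD.
    have -> : k * (t * t) + k * (t * t) + (k * (t * t) + k * (t * t)) = 1.
      by rewrite /k; field; rewrite gt_eqF.
    by rewrite rmorph1 mul1r.
  have := bounded_by_sc k (bounded_byD (bounded_byM ler01 u1 u1) (bounded_byM ler01 v1 v1)).
  by rewrite gtr0_norm // (_ : k * (1 * 1 + 1 * 1) = k + k) //; ring.
Qed.

(* With [L = (1 + d) e z], the element [1 + L^2] is again the square of some
   [e G] where [G^2] is near a scalar, so [L] is a contraction by the dilation. *)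
Lemma skew_quotient_contraction z c e m q : adjoint z = - z ->
  near_scalar c m q -> c * c = sc 4 - z * z -> c * z = z * c ->
  adjoint e = e -> (sc 2 + c) * e = 1 -> e * (sc 2 + c) = 1 ->
  exists k, [/\ 0 <= k, k < 1 & bounded_by (e * z) k].
Proof.
move=> zskew [m0 q01 csa cm] cc cz esa ce ec; have /andP[q0 q1] := q01.
have [b b0 zb] := adjop_bounded z.
pose b2 := b * b; have b20 : 0 <= b2 by rewrite mulr_ge0.
have zzb : bounded_by (z * z) b2 := bounded_byM b0 zb zb.
(* [d] is the margin that makes the contraction strict, small enough that ((1 + d)^2 - 1) |z|^2 <=
   3. *)
pose d := (1 + b2)^-1; have d0 : 0 < d by rewrite invr_gt0; lra.
have d1 : d <= 1 by rewrite invf_le1; lra.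
have db : d * b2 <= 1 by rewrite ler_pdivrMl; lra.
pose d2 := d + d + d * d.
have d20 : 0 < d2 by rewrite !addr_gt0 // mulr_gt0.
have d2b : d2 * b2 <= 3 by rewrite /d2; nra.
(* This is (2 + c)^2 (1 + L^2), expanded with c^2 = 4 - z^2 and d2 = (1 + d)^2 - 1; the error 3 from
   the last term stays below 8. *)
pose N := sc 8 + (sc 4 * c + sc d2 * (z * z)).
have nN : near_scalar N (8 + 4 * m) ((4 * (q * m) + 3) / (8 + 4 * m)).
  have p0 : 0 < 8 + 4 * m by lra.
  split=> //.
  - by rewrite divr_ge0 ?ltr_pdivrMr ?mul1r /=; nra.
  - rewrite /N !adjointD !adjointM !adjoint_sc csa zskew mulrNN.
    by rewrite !scC.
  - rewrite divfK ?gt_eqF //.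
    have -> : sc (8 + 4 * m) - N = sc 4 * (sc m - c) - sc d2 * (z * z).
      by rewrite /N rmorphD rmorphM; nc_ring.
    apply: bounded_byD.
      by have := bounded_by_sc 4 cm; rewrite gtr0_norm.
    apply/bounded_byN/(bounded_by_le d2b).
    by have := bounded_by_sc d2 zzb; rewrite gtr0_norm.
have [G [[_ _ Gsa _] GG GC]] := near_scalar_sqrt nN.
have ecomm B : B * c = c * B -> B * e = e * B.
  by move=> Bc; apply: (commute_inverse ce ec); rewrite mulrDr mulrDl scC Bc.
have zz_c : z * z * c = c * (z * z) by rewrite mulrA cz -!mulrA cz.
have Ncomm B : B * c = c * B -> B * (z * z) = z * z * B -> B * G = G * B.
  move=> Bc Bz; apply: GC; rewrite /N !mulrDr !mulrDl scC.
  by rewrite (sc_comm _ Bc) (sc_comm _ Bz).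
have eC : c * e = e * c by apply: ecomm.
have ez : z * e = e * z by apply: ecomm.
have Gc : c * G = G * c by apply: Ncomm.
have Gz : z * G = G * z by apply: Ncomm; rewrite ?mulrA.
have Ge : G * e = e * G by apply: ecomm.
pose L := sc (1 + d) * (e * z).
pose F := e * G.
have Lskew : adjoint L = - L.
  by rewrite !adjointM adjoint_sc esa zskew scC !mulNr ez mulrN.
have Fsa : adjoint F = F by rewrite adjointM esa Gsa Ge.
have LF : L * F = F * L.
  rewrite /L /F [RHS]mulrA scC -!mulrA; congr (_ * (e * _)).
  by rewrite [z * (e * G)]mulrA ez -mulrA Gz mulrA -Ge -mulrA.
have ee4 : e * e * (sc 4 + sc 4 * c + c * c) = 1.
  have -> : sc 4 + sc 4 * c + c * c = (sc 2 + c) * (sc 2 + c).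
    by rewrite sc4E sc2E; nc_ring.
  by rewrite -!mulrA [e * ((_ + _) * _)]mulrA ec mul1r ec.
have FF : F * F = 1 + L * L.
  have -> : F * F = e * e * N.
    by rewrite /F mulrA -[e * G * e]mulrA Ge mulrA -mulrA GG.
  have -> : L * L = e * e * (sc ((1 + d) * (1 + d)) * (z * z)).
    have -> : L * L = sc ((1 + d) * (1 + d)) * (e * z * (e * z)).
      exact: sc_mul.
    rewrite [RHS]mulrA scC -[RHS]mulrA; congr (_ * _).
    by rewrite -mulrA [z * (e * z)]mulrA ez !mulrA.
  rewrite -ee4 -mulrDr; congr (_ * _).
  rewrite /N; have -> : z * z = sc 4 - c * c by rewrite cc opprB addrC subrK.
  have -> : (1 + d) * (1 + d) = 1 + d2 by rewrite /d2; ring.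
  by rewrite sc8E (rmorphD _ 1 d2) rmorph1; nc_ring.
have [u1 v1 _] := skew_dilation Lskew Fsa FF LF.
have p1 : 0 < 1 + d by lra.
exists (1 + d)^-1; split.
- by rewrite invr_ge0; lra.
- by rewrite invf_lt1; lra.
have -> : e * z = sc ((1 + d)^-1 / 2) * ((F + L) - (F - L)).
  have -> : F + L - (F - L) = L + L by nc_ring.
  rewrite -mulrDl -rmorphD mulrA -rmorphM.
  have -> : (1 + d)^-1 / 2 * (1 + d + (1 + d)) = 1 by field; rewrite gt_eqF.
  by rewrite rmorph1 mul1r.
have := bounded_by_sc ((1 + d)^-1 / 2) (bounded_byD u1 (bounded_byN v1)).
rewrite gtr0_norm ?divr_gt0 ?invr_gt0 //.
by rewrite (_ : (1 + d)^-1 / 2 * (1 + 1) = (1 + d)^-1) //; field; rewrite gt_eqF.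
Qed.

End SkewAdjoint.

(** * Homotopy of idempotents *)

Section Homotopy.
Local Open Scope classical_set_scope.
Local Open Scope ring_scope.
Context {R : realType} {A : cstarAlgType R} {H : hilbertModType A}.
Implicit Types (T X Y P E Q : adjop H) (r s t : R).

Lemma opnorm_ge0 T : (0 <= opnorm T)%E.
Proof.
apply: ereal_sup_ubound; exists 0; first by rewrite /= normr0.
by rewrite adjop_fun0 normr0.
Qed.

Lemma opnorm_le T r : 0 <= r -> bounded_by T r -> (opnorm T <= r%:E)%E.
Proof.
move=> r0 Tr; apply: ge_ereal_sup => _ [x /= x1 <-]; rewrite lee_fin.
apply: le_trans (Tr x) _; rewrite ler_piMr // -lecR -nrmE.
by rewrite rmorph1.
Qed.

(** With D = Y - X the hypotheses give X D + D X = D and D^2 = 0, so the square of X + r D has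
    linear term r D and no quadratic term. *)
Lemma segment_idempotent X Y r : is_idempotent X -> is_idempotent Y ->
  X * Y + Y * X = X + Y -> is_idempotent (X + sc r * (Y - X)).
Proof.
rewrite /is_idempotent => XX YY XY.
have XD : X * (Y - X) + (Y - X) * X = Y - X.
  have -> : X * (Y - X) + (Y - X) * X = X * Y + Y * X - (X * X + X * X) by nc_ring.
  by rewrite XY XX; nc_ring.
have DD : (Y - X) * (Y - X) = 0.
  have -> : (Y - X) * (Y - X) = Y * Y + X * X - (X * Y + Y * X) by nc_ring.
  by rewrite XY YY XX; nc_ring.
move: (Y - X) XD DD => D XD DD.
rewrite mulrDl !mulrDr XX sc_mul DD mulr0 addr0 -addrA; congr (_ + _).
by rewrite mulrA scC -!mulrA -mulrDr XD.
Qed.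

(* [P] and [E] share their kernel, [E] and [Q] their range, so that both
   segments [P, E] and [E, Q] consist of idempotents. *)
Lemma homotopy_equivalent_segments P E Q :
  is_idempotent P -> is_idempotent E -> is_idempotent Q ->
  P * E = P -> E * P = E -> Q * E = E -> E * Q = Q -> homotopy_equivalent P Q.
Proof.
move=> PP EE QQ PE EP QE EQ.
(* On [0, 1], [f] runs from 0 to 1 in the first half and [g] in the second, so one Lipschitz formula
   traverses [P, E] and then [E, Q] without gluing paths. *)
pose f t := Num.min 1 (2 * t); pose g t := Num.max 0 (2 * t - 1).
pose gamma t : adjop H := P + sc (f t) * (E - P) + sc (g t) * (Q - E).
have fl s t : `|f s - f t| <= 2 * `|s - t|.
  have -> : 2 * `|s - t| = `|2 * (s - t)| by rewrite normrM normr_nat.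
  rewrite /f /Num.min.
  by case: ltP => h1; case: ltP => h2; rewrite ler_norml; apply/andP; split;
    case: (ger0P (2 * (s - t))); lra.
have gl s t : `|g s - g t| <= 2 * `|s - t|.
  have -> : 2 * `|s - t| = `|2 * (s - t)| by rewrite normrM normr_nat.
  rewrite /g /Num.max.
  by case: ltP => h1; case: ltP => h2; rewrite ler_norml; apply/andP; split;
    case: (ger0P (2 * (s - t))); lra.
exists gamma; split.
- rewrite /gamma /f /g mulr0 sub0r (min_idPr _) ?ler01 // (max_idPl _) ?lerN10 //.
  by rewrite rmorph0 !mul0r !addr0.
- rewrite /gamma /f /g mulr1 (min_idPl _) ?(max_idPr _); [|lra|lra].
  by rewrite (_ : 2 - 1 = 1 :> R) ?rmorph1 ?mul1r; [nc_ring|ring].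
- move=> t _; rewrite /gamma; have [t2|t2] := leP t 2^-1.
    rewrite /g (max_idPl _) ?rmorph0 ?mul0r ?addr0; last lra.
    by apply: segment_idempotent; rewrite // PE EP.
  rewrite /f (min_idPl _) ?rmorph1 ?mul1r; last lra.
  rewrite [P + _]addrC subrK; apply: segment_idempotent; rewrite // QE EQ.
  by rewrite addrC.
have [b b0 Db] := adjop_bounded (E - P); have [c c0 Dc] := adjop_bounded (Q - E).
have lip s t : (opnorm (gamma s - gamma t)%R <= ((2 * (b + c) * `|s - t|)%R)%:E)%E.
  apply: opnorm_le; first by rewrite !mulr_ge0 // addr_ge0.
  have -> : gamma s - gamma t = sc (f s - f t) * (E - P) + sc (g s - g t) * (Q - E).
    by rewrite !rmorphB /gamma; nc_ring.
  apply: bounded_by_le (bounded_byD (bounded_by_sc _ Db) (bounded_by_sc _ Dc)).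
  have := fl s t; have := gl s t; have := normr_ge0 (s - t).
  by nra.
move=> t _.
have cv : opnorm (gamma s - gamma t) @[s --> t] --> 0%E.
  apply: (@squeeze_cvge _ _ _ _ (fun=> 0%E) _ (fun s => (2 * (b + c) * `|s - t|)%:E)).
  - by apply: nearW => s; rewrite opnorm_ge0 lip.
  - exact: cvg_cst.
  - apply: cvg_EFin; first exact: nearW.
    rewrite [X in _ --> X](_ : _ = 2 * (b + c) * `|t - t|); last first.
      by rewrite subrr normr0 mulr0.
    apply: cvgM; first exact: cvg_cst.
    by apply: cvg_norm; apply: cvgB; [exact: cvg_id|exact: cvg_cst].
exact: cvg_within_filter cv.
Qed.

End Homotopy.

(** * The matched projection *)

Section Involutions.
Context {R : realType} {A : cstarAlgType R} {H : hilbertModType A}.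
Implicit Types (T X Y c : adjop H).

(** Turns involutions into idempotents, with inverse Q |-> 2 Q - 1; it is also applied to [S * J] to
    form the intertwiner. *)
Definition half_sum X : adjop H := sc 2^-1 * (1 + X).

Lemma sc_half_mul T X : T * (sc 2^-1 * X) = sc 2^-1 * (T * X).
Proof. by rewrite mulrA scC -mulrA. Qed.

Lemma sc_half_double T : sc 2^-1 * (T + T) = T.
Proof. by rewrite mulrDr sc_halfD. Qed.

Lemma sc_quarter T : sc 4^-1 * T = sc 2^-1 * (sc 2^-1 * T).
Proof. by rewrite mulrA -rmorphM; congr (sc _ * _); field. Qed.

Lemma mul_half_sum X : X * X = 1 -> X * half_sum X = half_sum X.
Proof. by move=> XX; rewrite /half_sum sc_half_mul mulrDr mulr1 XX addrC. Qed.

Lemma half_sum_mul X : X * X = 1 -> half_sum X * X = half_sum X.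
Proof. by move=> XX; rewrite /half_sum -mulrA mulrDl mul1r XX addrC. Qed.

Lemma half_sum_idempotent X : X * X = 1 -> is_idempotent (half_sum X).
Proof.
move=> XX; rewrite /is_idempotent {1}/half_sum -mulrA mulrDl mul1r mul_half_sum //.
exact: sc_half_double.
Qed.

Lemma half_sum_commute X T : T * X = X * T -> T * half_sum X = half_sum X * T.
Proof.
by move=> TX; rewrite /half_sum sc_half_mul mulrDr mulr1 TX -mulrA mulrDl mul1r.
Qed.

(** Compressing X Y + Y X = c by q = [half_sum Y], for which q Y = Y q = q, gives 2 q X q = c q.
    Used with both orders of the pair, it makes P Q P and Q P Q multiples of P and Q by the
    invertible (2 + c) / 4. *)
Lemma half_sum_sandwich X Y c : Y * Y = 1 -> X * Y + Y * X = c -> c * Y = Y * c ->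
  half_sum Y * half_sum X * half_sum Y = sc 4^-1 * ((sc 2 + c) * half_sum Y).
Proof.
move=> YY XYc cY; set q := half_sum Y.
have qq : q * q = q := half_sum_idempotent YY.
have cq : c * q = q * c := half_sum_commute cY.
have qY : q * Y = q := half_sum_mul YY.
have Yq : Y * q = q := mul_half_sum YY.
clearbody q.
have qXq : q * X * q + q * X * q = c * q.
  have -> : c * q = q * (X * Y + Y * X) * q by rewrite XYc -cq -mulrA qq.
  have -> : q * (X * Y + Y * X) * q = q * X * (Y * q) + q * Y * X * q by nc_ring.
  by rewrite qY Yq.
have -> : q * half_sum X * q = sc 2^-1 * (q + q * X * q).
  by rewrite [half_sum X]/half_sum sc_half_mul mulrDr mulr1 -mulrA mulrDl qq.
rewrite sc_quarter mulrDl -qXq sc2E mulrDl mul1r addrACA.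
by rewrite sc_half_double.
Qed.

End Involutions.

Theorem theorem3p1 (R : realType) (A : cstarAlgType R) (H : hilbertModType A)
    (Q : adjop H) (idemQ : is_idempotent Q) :
  exists P : adjop H, is_projection P /\
    (exists W V : adjop H,
      [/\ inverse_of W V, quasi_projection_pair P Q,
          Q = V * P * W & (opnorm (1 - W)%R < 1)%E]) /\
    homotopy_equivalent P Q.
Proof.
pose S := Q + Q - 1; pose S' := adjoint S.
have QS : Q = half_sum S by rewrite /half_sum /S addrC subrK sc_half_double.
have SS : S * S = 1.
  have -> : S * S = Q * Q + Q * Q + (Q * Q + Q * Q) - (Q + Q + (Q + Q)) + 1.
    by rewrite /S; nc_ring.
  by rewrite idemQ subrr add0r.
have S'S' : S' * S' = 1 by rewrite -adjointM SS adjoint1.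
have S'E : S' = adjoint S by [].
clearbody S.
pose a := S + S'; pose z := S - S'.
have asa : adjoint a = a by rewrite /a adjointD adjointK addrC.
have zskew : adjoint z = - z by rewrite /z opprB adjointB adjointK.
have aa : a * a = sc 4 - z * z.
  have -> : a * a = S * S + S * S + (S' * S' + S' * S') - z * z.
    by rewrite /a /z; nc_ring.
  by rewrite SS S'S' sc4E.
have az : a * z = - (z * a).
  have -> : a * z = S * S + S * S - (S' * S' + S' * S') - z * a.
    by rewrite /a /z; nc_ring.
  by rewrite SS S'S' subrr sub0r.
have Saz : S = sc 2^-1 * (a + z).
  have -> : a + z = S + S by rewrite /a /z; nc_ring.
  by rewrite sc_half_double.
have zE : z = S - S' by [].
have aE : a = S + S' by [].
clearbody a z.
(* [ltr0Sn R 3] is 0 < 4, so the operator obtained is 4 - z^2 = a^2. *)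
have [m [q near_aa]] := skew_near_scalar zskew (ltr0Sn R 3).
have [c [near_c cc cC]] := near_scalar_sqrt near_aa.
have cz : z * c = c * z by apply: cC; rewrite mulrBr mulrBl scC mulrA.
have ca : a * c = c * a by apply: cC; rewrite -aa mulrA.
have [_ _ csa _] := near_c.
have [ci [cisa cci cic]] := near_scalar_inv near_c.
have [e [esa ne en]] := near_scalar_inv (near_scalarD (ler0n R 2) near_c).
set n := sc 2 + c in ne en.
pose J := a * ci.
have comm_ci B : B * c = c * B -> B * ci = ci * B by apply: commute_inverse.
have Jsa : adjoint J = J by rewrite /J adjointM asa cisa comm_ci.
have Jc : J * c = a by rewrite -mulrA cic mulr1.
have cJ : c * J = a by rewrite mulrA -ca -mulrA cci mulr1.
have JJ : J * J = 1.
  have -> : J * J = a * (ci * a) * ci by rewrite /J !mulrA.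
  by rewrite -comm_ci // mulrA aa -cc -[c * c * ci]mulrA cci mulr1.
have Jz : J * z = - (z * J).
  by rewrite /J -mulrA -comm_ci // mulrA az mulNr mulrA.
have aJ : a * J = c by rewrite -cJ -mulrA JJ mulr1.
have Ja : J * a = c by rewrite -Jc mulrA JJ mul1r.
have comm_e B : B * c = c * B -> B * e = e * B.
  by move=> Bc; apply: (commute_inverse ne en); rewrite mulrDr mulrDl scC Bc.
have SJ : S * J = sc 2^-1 * (c + z * J) by rewrite Saz -mulrA mulrDl aJ.
have JS : J * S = sc 2^-1 * (c - z * J) by rewrite Saz sc_half_mul mulrDr Ja Jz.
have SJc : S * J + J * S = c.
  by rewrite SJ JS -mulrDr addrACA subrr addr0 sc_half_double.
have JSc : J * S + S * J = c by rewrite addrC.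
clearbody J.
have cS : c * S = S * c by rewrite Saz sc_half_mul -mulrA mulrDr mulrDl cz ca.
have cJc : c * J = J * c by rewrite cJ Jc.
pose P := half_sum J.
have PP : is_idempotent P := half_sum_idempotent JJ.
have projP : is_projection P.
  by split=> //; rewrite adjointM adjointD adjoint1 adjoint_sc Jsa scC.
(* As [J] anticommutes with [z], moving [z] across exchanges [P] and [1 - P]. *)
have Pz : P * z = z * (1 - P).
  have -> : 1 - P = sc 2^-1 * (1 - J).
    by rewrite -[X in X - _](sc_half_double 1) -mulrBr addrKA.
  by rewrite sc_half_mul -mulrA mulrDl mulrBr mul1r mulr1 Jz.
have adjQ : adjoint Q = half_sum S'.
  by rewrite QS /half_sum adjointM adjointD adjoint1 adjoint_sc scC S'E.
have adjQB : adjoint Q = Q - sc 2^-1 * z.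
  by rewrite adjQ [in RHS]QS /half_sum -mulrBr zE; congr (_ * _); nc_ring.
have adjQD : adjoint Q + Q = 1 + sc 2^-1 * a.
  rewrite adjQ [in LHS]QS /half_sum -mulrDr aE.
  have -> : 1 + S' + (1 + S) = 1 + 1 + (S + S') by nc_ring.
  by rewrite mulrDr sc_half_double.
have aP : a * P = P * a by apply: half_sum_commute; rewrite aJ Ja.
have cP : c * P = P * c := half_sum_commute cJc.
have cQ : c * Q = Q * c by rewrite QS; exact: half_sum_commute cS.
have eP : e * P = P * e by rewrite comm_e.
have eQ : e * Q = Q * e by rewrite comm_e.
have P1P : P * (1 - P) = 0 by rewrite mulrBr mulr1 PP subrr.
have PP1 : (1 - P) * P = 0 by rewrite mulrBl mul1r PP subrr.
have zP : (1 - P) * z = z * P.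
  by rewrite mulrBl mul1r Pz mulrBr mulr1 opprB addrC subrK.
have PQP : P * Q * P = sc 4^-1 * (n * P).
  by rewrite QS; apply: half_sum_sandwich JJ SJc cJc.
have QPQ : Q * P * Q = sc 4^-1 * (n * Q).
  by rewrite QS; apply: half_sum_sandwich SS JSc cS.
have P_half : P = sc 2^-1 * (1 + J) by [].
clearbody P.
have hz T : T * (sc 2^-1 * z) * T = sc 2^-1 * (T * z * T).
  by rewrite sc_half_mul -mulrA.
(* Q^* - Q = - z / 2 is off-diagonal with respect to [P], which gives the two diagonal conditions;
   Q^* + Q = 1 + a / 2 commutes with [P], which gives the off-diagonal one. *)
have qpp : quasi_projection_pair P Q.
  split=> //.
  - by rewrite adjQB mulrBr mulrBl hz Pz -[z * _ * P]mulrA PP1 !mulr0 subr0.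
  - apply/eqP; rewrite -addr_eq0 -mulrDl -mulrDr adjQD.
    rewrite (_ : P * _ = (1 + sc 2^-1 * a) * P) -?mulrA ?P1P ?mulr0 //.
    by rewrite mulrDr mulrDl mulr1 mul1r sc_half_mul -aP mulrA.
  - by rewrite adjQB (mulrBr (1 - P)) mulrBl hz zP -[z * P * _]mulrA P1P !mulr0 subr0.
pose y := z * J.
have yy : y * y = c * c - sc 4.
  have -> : y * y = z * (J * z) * J by rewrite /y !mulrA.
  rewrite Jz mulrN mulNr -!mulrA JJ mulr1 cc [in RHS]addrAC subrr sub0r.
  by [].
have cy : c * y = y * c by rewrite /y mulrA -cz -!mulrA cJc.
have ye : y * e = e * y by rewrite comm_e.
have yE : y = z * J by [].
clearbody y.
(* Since y^2 = c^2 - 4 and [y] commutes with [c], the product is (2 + c)^2 - c^2 + 4 = 4 (2 + c);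
   hence (n + y) / 4 has inverse e (n - y). *)
have nyD : (n + y) * (n - y) = sc 4 * n.
  have -> : (n + y) * (n - y) = n * n - y * y + (y * c - c * y).
    by rewrite /n sc2E; nc_ring.
  by rewrite cy subrr addr0 yy /n sc2E sc4E; nc_ring.
have nyB : (n - y) * (n + y) = sc 4 * n.
  have -> : (n - y) * (n + y) = n * n - y * y + (c * y - y * c).
    by rewrite /n sc2E; nc_ring.
  by rewrite cy subrr addr0 yy /n sc2E sc4E; nc_ring.
have sc4V : sc 4^-1 * sc 4 = 1 :> adjop H.
  by rewrite -rmorphM mulVf ?rmorph1.
have sc44V : sc 4 * sc 4^-1 = 1 :> adjop H by rewrite scC.
have ny_e : (n + y) * e = e * (n + y) by rewrite mulrDl mulrDr ne en ye.
pose W := e * (n - y); pose V := half_sum (S * J).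
have VE : V = sc 4^-1 * (n + y).
  rewrite /V /half_sum SJ sc_quarter /n sc2E -yE; congr (_ * _).
  by rewrite -(addrA (1 + 1)) [RHS]mulrDr sc_half_double.
have VW : V * W = 1.
  rewrite VE /W -mulrA [(n + y) * _]mulrA ny_e -mulrA nyD [e * _]mulrA scC -mulrA en.
  by rewrite mulr1.
have WV : W * V = 1.
  rewrite VE /W mulrA scC -!mulrA nyB [e * _]mulrA scC -mulrA en mulr1.
  exact: sc4V.
have W1 : 1 - W = e * z * J by rewrite /W mulrBr en opprB addrC subrK yE mulrA.
(* Both S (1 + S J) and (1 + S J) J equal S + J. *)
have SV : S * V = V * J.
  rewrite /V /half_sum sc_half_mul -mulrA; congr (_ * _).
  by rewrite mulrDr mulrDl mulr1 mul1r mulrA SS mul1r -mulrA JJ mulr1 addrC.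
have QV : Q * V = V * P.
  rewrite QS P_half {1}/half_sum -mulrA mulrDl mul1r SV sc_half_mul.
  by rewrite [V * (1 + J)]mulrDr mulr1.
exists P; split=> //; split.
  exists W, V; split=> //.
    by rewrite -QV -mulrA VW mulr1.
  (* A uniform k < 1 is needed because [opnorm] is a supremum; the unitary [J] in 1 - W = e z J does
     not affect the bound. *)
  have [k [k0 k1 ezk]] :
      exists k, [/\ 0 <= k, k < 1 & bounded_by (e * z) k].
    exact: skew_quotient_contraction zskew near_c cc (esym cz) esa ne en.
  apply: (@le_lt_trans _ _ k%:E); last by rewrite lte_fin.
  apply: opnorm_le => //; rewrite W1.
  have J1 : bounded_by J 1 by apply: isometry_bounded; rewrite Jsa.
  by have := bounded_byM k0 ezk J1; rewrite mulr1.
(* The factor 4 e, inverse to (2 + c) / 4, normalizes Q P into the idempotent with the range of [Q]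
   and the kernel of [P]. *)
pose E := sc 4 * (Q * e * P).
have PE : P * E = P.
  have -> : P * E = sc 4 * (P * Q * P * e).
    by rewrite /E mulrA scC -!mulrA eP.
  by rewrite PQP -mulrA mulrA sc44V mul1r -mulrA -eP mulrA ne mul1r.
have EP : E * P = E by rewrite /E -!mulrA PP.
have QE : Q * E = E by rewrite /E mulrA scC -!mulrA [Q * (Q * _)]mulrA idemQ.
have EQ : E * Q = Q.
  have -> : E * Q = sc 4 * (e * (Q * P * Q)) by rewrite /E -eQ -!mulrA.
  by rewrite QPQ [e * _]mulrA scC -mulrA [e * _]mulrA en mul1r mulrA sc44V mul1r.
have EE : is_idempotent E.
  by rewrite /is_idempotent -{1}EP -mulrA PE EP.
exact: homotopy_equivalent_segments PP EE idemQ PE EP QE EQ.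
Qed.
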